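(* Let $J$ be a Jacobi operator with diagonal entries $(\alpha_k)_{k\ge 0}$ and off-diagonal entries $(\beta_k)_{k\ge 0}$, and suppose there exists a positive integer $n$ such that $\alpha_k=0$ and $\beta_{k-1}=\tfrac12$ for all $k\ge n$. Then the entries $c_{i,j}$ of the connection coefficient matrix $C=C_{J\to\Delta}$ satisfy $$c_{i,j}=c_{i-1,j-1}\quad\text{for all } i,j>0 \text{ such that } i+j\ge 2n,$$ $$c_{0,j}=0\quad\text{for all } j\ge 2n.$$
   Context: All matrices are indexed from $0$. A Jacobi operator $J$ is a bounded self-adjoint operator on $\ell^2(\{0,1,2,\dots\})$ given by a symmetric tridiagonal matrix with real diagonal entries $J_{k,k}=\alpha_k$ and off-diagonal entries $J_{k,k+1}=J_{k+1,k}=\beta_k>0$. Its orthonormal polynomials are defined by $P_{-1}=0$, $P_0=1$, $sP_k(s)=\beta_{k-1}P_{k-1}(s)+\alpha_kP_k(s)+\beta_kP_{k+1}(s)$. The free Jacobi operator $\Delta$ has diagonal entries $0$ and off-diagonal entries $\tfrac12$; its orthonormal polynomials are the Chebyshev polynomials of the second kind $U_k$. The connection coefficient matrix $C_{J\to\Delta}=(c_{i,j})_{i,j\ge0}$ is the upper triangular matrix defined by $P_k=\sum_{i=0}^k c_{i,k}U_i$. *)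

(* Defs.v *)
From HB Require Import structures.
From mathcomp Require Import all_boot all_order all_algebra.
From mathcomp Require Import all_classical all_reals all_analysis.
From mathcomp Require Import ring lra.

Set Implicit Arguments.
Unset Strict Implicit.
Unset Printing Implicit Defensive.

Import Order.TTheory GRing.Theory Num.Theory.
Local Open Scope ring_scope.

(* [y_{k-1}], with the convention [y_{-1} = 0]. *)
Definition pred_entry (V : nmodType) (y : nat -> V) (k : nat) : V :=
  if k is k'.+1 then y k' else 0.

Definition l2_normsq (R : realType) (x : nat -> R) : \bar R :=
  (\sum_(0 <= k <oo) (x k ^+ 2)%:E)%E.

(* The action on sequences of the symmetric tridiagonal matrix with diagonal
   [alpha] and off-diagonal [beta]. *)
Definition tridiag_apply (R : realType) (alpha beta x : nat -> R) (k : nat) : R :=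
  pred_entry (fun l => beta l * x l) k + alpha k * x k + beta k * x k.+1.

Definition l2_bounded (R : realType) (T : (nat -> R) -> nat -> R) : Prop :=
  exists M : R, forall x : nat -> R, (l2_normsq x < +oo)%E ->
    (l2_normsq (T x) <= M%:E * l2_normsq x)%E.

(* Self-adjointness needs no field of its own: the matrix is symmetric by
   construction and the operator is bounded. *)
Record jacobi (R : realType) := Jacobi {
  diag : nat -> R;
  offdiag : nat -> R;
  offdiag_gt0 : forall k, 0 < offdiag k;
  jacobi_bounded : l2_bounded (tridiag_apply diag offdiag) }.

(* The three-term recurrence solved for [P_{k+1}]; see [orthpolyE]. *)
Fixpoint orthpoly (R : realType) (J : jacobi R) (k : nat) : {poly R} :=
  match k with
  | 0 => 1
  | k'.+1 => (offdiag J k')^-1 *: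
      (('X - (diag J k')%:P) * orthpoly J k' -
       match k' with
       | 0 => 0
       | k''.+1 => offdiag J k'' *: orthpoly J k''
       end)
  end.

Lemma orthpolyE (R : realType) (J : jacobi R) (k : nat) :
  'X * orthpoly J k =
  pred_entry (fun l => offdiag J l *: orthpoly J l) k +
  diag J k *: orthpoly J k + offdiag J k *: orthpoly J k.+1.
Proof.
have b0 : offdiag J k != 0 by rewrite gt_eqF ?offdiag_gt0.
have -> : orthpoly J k.+1 = (offdiag J k)^-1 *:
    (('X - (diag J k)%:P) * orthpoly J k
     - pred_entry (fun l => offdiag J l *: orthpoly J l) k) by case: k {b0}.
rewrite scalerA mulfV // scale1r mulrBl mul_polyC.
set a := pred_entry _ _; set b := _ *: _; set c := 'X * _.
by ring.
Qed.

(* [C] is the connection coefficient matrix from the orthonormal polynomials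
   of [J] to those of [D]. *)
Definition is_connection (R : realType) (J D : jacobi R) (C : nat -> nat -> R) :
    Prop :=
  (forall i j, (j < i)%N -> C i j = 0) /\
  (forall k, orthpoly J k = \sum_(i < k.+1) C i k *: orthpoly D i).

Lemma size_orthpoly (R : realType) (J : jacobi R) (k : nat) :
  size (orthpoly J k) = k.+1.
Proof.
elim/ltn_ind: k => -[|k] IH; first by rewrite /= size_poly1.
have b0 : (offdiag J k)^-1 != 0 by rewrite invr_eq0 gt_eqF ?offdiag_gt0.
have sk := IH k (ltnSn k).
have P0 : orthpoly J k != 0 by rewrite -size_poly_eq0 sk.
have sX : size (('X - (diag J k)%:P) * orthpoly J k) = k.+2.
  by rewrite size_monicM ?monicXsubC // size_XsubC sk.
rewrite [orthpoly J k.+1]/= size_scale // size_polyDl // sX size_polyN.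
case: k IH {b0 sk P0 sX} => [|k] IH; first by rewrite size_poly0.
by rewrite (leq_ltn_trans (size_scale_leq _ _)) // IH.
Qed.

Lemma orthpoly_span (R : realType) (J : jacobi R) (m : nat) (p : {poly R}) :
  (size p <= m)%N -> exists c : nat -> R, p = \sum_(i < m) c i *: orthpoly J i.
Proof.
elim: m p => [|m IH] p sp.
  by exists (fun=> 0); rewrite big_ord0; apply/eqP; rewrite -size_poly_leq0.
set P := orthpoly J m; set a := p`_m / P`_m.
have Pm : P`_m != 0.
  by rewrite -[m in P`_m]/(m.+1.-1) -(size_orthpoly J m) lead_coef_eq0
             -size_poly_eq0 size_orthpoly.
have [|c cE] := IH (p - a *: P).
  apply/leq_sizeP => j; rewrite leq_eqVlt => /predU1P[<-|mj].
    by rewrite coefB coefZ divfK // subrr.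
  rewrite coefB coefZ !nth_default ?size_orthpoly ?mulr0 ?subr0 //.
  exact: leq_trans mj.
exists (fun i => if (i < m)%N then c i else a).
rewrite big_ord_recr /= ltnn -[p in LHS](subrK (a *: P)) cE; congr (_ + _).
by apply: eq_bigr => i _; rewrite ltn_ord.
Qed.

Lemma orthpoly_free (R : realType) (J : jacobi R) (m : nat) (c : nat -> R) :
  \sum_(i < m) c i *: orthpoly J i = 0 -> forall i, (i < m)%N -> c i = 0.
Proof.
elim: m => // m IH; rewrite big_ord_recr /= => s0.
have Pm : (orthpoly J m)`_m != 0.
  by rewrite -[m in _`_m]/(m.+1.-1) -(size_orthpoly J m) lead_coef_eq0
             -size_poly_eq0 size_orthpoly.
have cm : c m = 0.
  have /polyP/(_ m) := s0; rewrite coefD coefZ coef0 coef_sum big1.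
    by rewrite add0r => /eqP; rewrite mulf_eq0 (negPf Pm) orbF => /eqP.
  by move=> i _; rewrite coefZ nth_default ?mulr0 // size_orthpoly.
move: s0; rewrite cm scale0r addr0 => /IH c0 i.
by rewrite ltnS leq_eqVlt => /predU1P[->|/c0].
Qed.

Lemma connection_exists (R : realType) (J D : jacobi R) :
  exists C, is_connection J D C.
Proof.
have /choice[c cE] : forall k, exists c : nat -> R,
    orthpoly J k = \sum_(i < k.+1) c i *: orthpoly D i.
  by move=> k; apply: orthpoly_span; rewrite size_orthpoly.
exists (fun i j => if (j < i)%N then 0 else c j i); split=> [i j -> //|k].
by rewrite cE; apply: eq_bigr => i _; rewrite ltnNge -ltnS ltn_ord.
Qed.

Lemma connection_unique (R : realType) (J D : jacobi R) (C C' : nat -> nat -> R) :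
  is_connection J D C -> is_connection J D C' -> forall i j, C i j = C' i j.
Proof.
move=> [C0 CE] [C0' CE'] i j; have [ji|ij] := ltnP j i.
  by rewrite C0 ?C0'.
apply/eqP; rewrite -subr_eq0; apply/eqP.
apply: (@orthpoly_free _ D j.+1 (fun l => C l j - C' l j)) => //.
under eq_bigr do rewrite scalerBl.
by rewrite big_split /= sumrN -CE -CE' subrr.
Qed.

Lemma free_jacobi_bounded (R : realType) :
  l2_bounded (tridiag_apply (fun=> 0 : R) (fun=> 2^-1)).
Proof.
exists 1 => x _; rewrite mul1e.
pose y k := pred_entry x k.
have yx : l2_normsq y = l2_normsq x.
  rewrite /l2_normsq nneseries_recl //=; last by move=> k _; rewrite lee_fin sqr_ge0.
  rewrite expr0n /= add0e -nneseries_addn; last first.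
    by move=> k; rewrite lee_fin sqr_ge0.
  by apply: eq_eseriesr => k _; rewrite addn1.
pose z k := x k.+1.
have zx : (l2_normsq z <= l2_normsq x)%E.
  rewrite /l2_normsq [leRHS]nneseries_recl //=; last first.
    by move=> k _; rewrite lee_fin sqr_ge0.
  rewrite -[in leRHS]nneseries_addn; last by move=> k; rewrite lee_fin sqr_ge0.
  under [X in (_ <= _ + X)%E]eq_eseriesr do rewrite addn1.
  by rewrite -[leLHS]add0e leeD ?lee_fin ?sqr_ge0.
have sqE (w : nat -> R) k : (0 <= (w k ^+ 2)%:E)%E by rewrite lee_fin sqr_ge0.
apply: (@le_trans _ _ (2^-1%:E * (l2_normsq y + l2_normsq z))%E).
  rewrite /l2_normsq -nneseriesD // -nneseriesZl; last by move=> i _; rewrite adde_ge0.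
  apply: lee_nneseries => [i _ _|k _]; first exact: sqE.
  rewrite -EFinD -EFinM lee_fin /tridiag_apply /y /z.
  have -> : pred_entry (fun l => 2^-1 * x l) k = 2^-1 * pred_entry x k.
    by case: k => //=; rewrite mulr0.
  set a := pred_entry x k; set b := x k.+1.
  have := sqr_ge0 (a - b); rewrite mul0r; nra.
have l0 (w : nat -> R) : (0 <= l2_normsq w)%E.
  by apply: nneseries_ge0 => k _ _; exact: sqE.
apply: (@le_trans _ _ (2^-1%:E * (l2_normsq x + l2_normsq x))%E).
  by rewrite yx lee_wpmul2l ?lee_fin ?invr_ge0 // leeD2l.
rewrite ge0_muleDr // -ge0_muleDl ?lee_fin ?invr_ge0 // -EFinD.
have -> : 2^-1 + 2^-1 = 1 :> R by lra.
by rewrite mul1e.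
Qed.

Definition free_jacobi (R : realType) : jacobi R :=
  @Jacobi R (fun=> 0) (fun=> 2^-1)
    (fun=> etrans (invr_gt0 2) (ltr0n R 2)) (@free_jacobi_bounded R).

(* The orthonormal polynomials of the free Jacobi operator satisfy the
   recurrence of the Chebyshev polynomials of the second kind. *)
Lemma orthpoly_free_jacobi (R : realType) :
  [/\ orthpoly (free_jacobi R) 0 = 1, orthpoly (free_jacobi R) 1 = 2 *: 'X &
   forall k, orthpoly (free_jacobi R) k.+2 =
     2 *: ('X * orthpoly (free_jacobi R) k.+1) - orthpoly (free_jacobi R) k].
Proof.
split=> [//||k]; first by rewrite /= invrK mulr1 !subr0.
have -> : orthpoly (free_jacobi R) k.+2 = (2^-1)^-1 *: (('X - 0%:P) *
  orthpoly (free_jacobi R) k.+1 - 2^-1 *: orthpoly (free_jacobi R) k) by [].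
by rewrite invrK subr0 scalerBr scalerA mulfV ?pnatr_eq0 // scale1r.
Qed.

(* Main.v *)
(** Expanding [x P_k] in the two bases gives a two-dimensional recurrence for
    the connection coefficients. Put [d i j = C i j - C (i-1) (j-1)], where
    [C (-1) _ = 0]. In the region where [J] agrees with the free operator, the
    recurrence says [d i (j+1) = d (i+1) j], so [d i j] with [j >= n] can be
    moved along its antidiagonal to column [n]. There it vanishes as soon as
    [i + j >= 2n]: below the diagonal by triangularity, and on the diagonal
    because the last coefficient [beta_(n-1)] is already [1/2]. *)
Require Import Defs.
From mathcomp Require Import all_boot all_order all_algebra.
From mathcomp Require Import all_classical all_reals all_analysis.
From mathcomp Require Import ring lra zify.

Import Order.TTheory GRing.Theory Num.Theory.
Local Open Scope ring_scope.

(* The two [pred_entry] terms are the boundary terms of the summation by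
   parts. *)
Lemma mulX_orthpoly_sum (R : realType) (J : jacobi R) (c : nat -> R) (m : nat) :
  'X * (\sum_(i < m) c i *: orthpoly J i)
    + pred_entry (fun l => (offdiag J l * c l.+1) *: orthpoly J l) m =
  \sum_(i < m) tridiag_apply (diag J) (offdiag J) c i *: orthpoly J i
    + pred_entry (fun l => (offdiag J l * c l) *: orthpoly J l.+1) m.
Proof.
elim: m => [|m]; first by rewrite !big_ord0 mulr0.
move/eqP; rewrite -subr_eq => /eqP IH.
rewrite !big_ord_recr /= mulrDr -scalerAr orthpolyE -addrA -IH.
rewrite /tridiag_apply; case: m {IH} => [|m] /=; rewrite -!mul_polyC; ring.
Qed.

(** Zero padding lets columns [k - 1], [k] and [k + 1] share one summation range. *)
Lemma orthpoly_connection (R : realType) (J D : jacobi R) (C : nat -> nat -> R)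
    (k m : nat) :
  is_connection J D C -> (k < m)%N ->
  orthpoly J k = \sum_(i < m) C i k *: orthpoly D i.
Proof.
move=> [C0 CE] km; rewrite CE (big_ord_widen m (fun i => C i k *: orthpoly D i)) //.
rewrite big_mkcond; apply: eq_bigr => i _.
by case: ltnP => // ki; rewrite C0 // scale0r.
Qed.

Arguments orthpoly_connection {R J D C k m}.

(** Both sides are the coefficient of [orthpoly D i] in ['X * orthpoly J k]. *)
Lemma connection_recurrence (R : realType) (J D : jacobi R)
    (C : nat -> nat -> R) (i k : nat) :
  is_connection J D C ->
  tridiag_apply (diag D) (offdiag D) (C^~ k) i =
  tridiag_apply (diag J) (offdiag J) (C i) k.
Proof.
(* This [m] exceeds [k + 1], so the boundary terms at [m] lie below the diagonal and vanish. *)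
move=> CJD; have C0 := CJD.1; pose m := (i + k).+2.
apply/eqP; rewrite -subr_eq0; apply/eqP; move: i @m => i0 m.
apply: (@orthpoly_free _ D m (fun i =>
  tridiag_apply (diag D) (offdiag D) (C^~ k) i
    - tridiag_apply (diag J) (offdiag J) (C i) k)); last by rewrite /m; lia.
under eq_bigr do rewrite scalerBl.
rewrite big_split /= sumrN; apply/eqP; rewrite subr_eq0; apply/eqP.
have := @mulX_orthpoly_sum _ D (C^~ k) m.
rewrite /= !C0 ?mulr0 ?scale0r ?addr0 ?ltnS ?leq_addl //; last by lia.
move=> <-; rewrite -(orthpoly_connection CJD); last by rewrite /m; lia.
rewrite orthpolyE /tridiag_apply.
under [RHS]eq_bigr do rewrite !scalerDl -!scalerA.
rewrite !big_split /= -!scaler_sumr.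
rewrite -!(orthpoly_connection CJD) ?[(_ < m)%N]/m; try lia.
congr (_ + _ + _); case: k @m => [|k] m /=.
  by under eq_bigr do rewrite scale0r; rewrite big1.
under eq_bigr do rewrite -scalerA.
by rewrite -scaler_sumr -(orthpoly_connection CJD) // /m; lia.
Qed.

Theorem theorem4p8 (R : realType) (J : jacobi R) (n : nat)
    (C : nat -> nat -> R)
    (n_gt0 : (0 < n)%N)
    (diagJ : forall k : nat, (n <= k)%N -> diag J k = 0)
    (offdiagJ : forall k : nat, (n <= k)%N -> offdiag J k.-1 = 2^-1)
    (CE : is_connection J (free_jacobi R) C) :
  (forall i j : nat, (0 < i)%N -> (0 < j)%N -> (2 * n <= i + j)%N ->
     C i j = C i.-1 j.-1) /\
  (forall j : nat, (2 * n <= j)%N -> C 0%N j = 0).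
Proof.
have C0 := CE.1.
have rec i k := @connection_recurrence _ _ _ _ i k CE.
have antidiag i k : (n <= k)%N ->
    C i k.+1 - pred_entry (C^~ k) i = C i.+1 k - C i k.-1.
  case: k => [|k] nk; first lia.
  have := rec i k.+1; rewrite /tridiag_apply /= diagJ //.
  rewrite (offdiagJ k.+1) // (offdiagJ k.+2) ?(leqW nk) //.
  by case: i => [|i] /=; lra.
have diag_n : C n n = C n.-1 n.-1.
  case: n n_gt0 offdiagJ {diagJ antidiag} => // m _ offdiagJ.
  (* At row [n], column [n - 1], triangularity kills every term except the two diagonal ones. *)
  have := rec m.+1 m; rewrite /tridiag_apply /= (offdiagJ m.+1) //.
  rewrite (C0 m.+2 m) ?(C0 m.+1 m) //.
  case: m {offdiagJ} => [|m] /=; first lra.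
  by rewrite (C0 m.+2 m) //; lra.
(* With [j = n + m], the hypothesis is [2n <= i + j], and induction on [m] follows the
   antidiagonal. *)
have d0 m i : (n <= i + m)%N -> C i (n + m)%N = pred_entry (C^~ (n + m).-1) i.
  elim: m i => [|m IH] i nim.
    case: i nim => [|i] /= nim; first lia.
    rewrite addn0 in nim; rewrite addn0; have [in_|in_] := eqVneq i.+1 n.
      by rewrite -in_ in diag_n *.
    by rewrite !C0 //; lia.
  apply/eqP; rewrite addnS -subr_eq0 antidiag ?leq_addr // IH ?addSnnS //.
  by rewrite subrr.
split=> [[|i] [|j] // _ _ nij|j nj].
  (* Left of column [n], the bound on the index sum forces both entries below the diagonal. *)
  have [jn|nj] := ltnP j.+1 n; first by rewrite !C0 //; lia.
  by have := d0 (j.+1 - n)%N i.+1; rewrite subnKC //; apply; lia.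
by have := d0 (j - n)%N 0%N; rewrite subnKC; [apply; lia|lia].
Qed.
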